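(* Let $T$ be a tree that has a perfect matching. Then $$\mathrm{Pm}(P_3\times T)=\prod\left(2+\alpha^2\right),$$ where the product ranges over all positive eigenvalues $\alpha$ of $T$, each repeated according to its multiplicity.
   Context: For a graph $G$, $\mathrm{Pm}(G)$ denotes the number of perfect matchings of $G$. $P_3$ is the path with 3 vertices, and $G\times H$ denotes the Cartesian product of graphs $G$ and $H$. The eigenvalues of a graph are the eigenvalues of its (0,1) adjacency matrix. *)

(* Defs.v *)
From HB Require Import structures.
From mathcomp Require Import all_boot all_order all_algebra.

Set Implicit Arguments.
Unset Strict Implicit.
Unset Printing Implicit Defensive.

Import Order.TTheory GRing.Theory Num.Theory.

Local Open Scope ring_scope.

Record sgraph := SGraph {
  vertex :> finType;
  adj : rel vertex;
  adj_sym : symmetric adj;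
  adj_irrefl : irreflexive adj
}.

Definition edges (G : sgraph) : {set {set G}} :=
  [set [set x; y] | x in G, y in G & adj x y].

Definition perfect_matching (G : sgraph) (M : {set {set G}}) : bool :=
  (M \subset edges G) && [forall v : G, #|[set A in M | v \in A]| == 1%N].

Definition Pm (G : sgraph) : nat :=
  #|[set M : {set {set G}} | perfect_matching M]|.

(* A cycle is a duplicate-free cyclic sequence of at least three vertices;
   [ucycle] also holds of the empty sequence and of the two ends of an edge. *)
Definition acyclic (G : sgraph) : Prop :=
  forall c : seq G, ucycle (@adj G) c -> (size c < 3)%N.

Definition connected (G : sgraph) : Prop :=
  (0 < #|G|)%N /\ forall x y : G, connect (@adj G) x y.

Definition tree (G : sgraph) : Prop := connected G /\ acyclic G.

Definition path_adj (n : nat) : rel 'I_n :=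
  fun i j => (i.+1 == j :> nat) || (j.+1 == i :> nat).

Lemma path_adj_sym n : symmetric (@path_adj n).
Proof. by move=> i j; rewrite /path_adj orbC. Qed.

Lemma path_adj_irrefl n : irreflexive (@path_adj n).
Proof. by move=> i; rewrite /path_adj orbb eqn_leq ltnn. Qed.

(* [path_graph n] has n vertices, hence n - 1 edges. *)
Definition path_graph (n : nat) : sgraph :=
  SGraph (@path_adj_sym n) (@path_adj_irrefl n).

Definition cart_adj (G H : sgraph) : rel (G * H) :=
  fun u v => ((u.1 == v.1) && adj u.2 v.2) || (adj u.1 v.1 && (u.2 == v.2)).

Lemma cart_adj_sym (G H : sgraph) : symmetric (@cart_adj G H).
Proof.
by move=> u v; rewrite /cart_adj !(adj_sym _ v.1) !(adj_sym _ v.2) !(eq_sym v.1)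
  !(eq_sym v.2).
Qed.

Lemma cart_adj_irrefl (G H : sgraph) : irreflexive (@cart_adj G H).
Proof. by move=> u; rewrite /cart_adj !adj_irrefl andbF. Qed.

Definition cart_prod (G H : sgraph) : sgraph :=
  SGraph (@cart_adj_sym G H) (@cart_adj_irrefl G H).

Definition adjmx (R : nzRingType) (G : sgraph) : 'M[R]_#|G| :=
  \matrix_(i, j) (adj (enum_val i) (enum_val j))%:R.

(* The roots of the characteristic polynomial with multiplicity, in an
   unspecified order. Working over C makes the polynomial split; the order of a
   numClosedFieldType is partial, and [0 < a] says that a is real and positive. *)
Definition eigenvalues (C : numClosedFieldType) (n : nat) (A : 'M[C]_n) : seq C :=
  sval (closed_field_poly_normal (char_poly A)).

Lemma char_poly_eigenvalues (C : numClosedFieldType) (n : nat) (A : 'M[C]_n) :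
  char_poly A = \prod_(a <- eigenvalues A) ('X - a%:P).
Proof.
rewrite /eigenvalues; case: closed_field_poly_normal => s /= {1}->.
by rewrite (monicP (char_poly_monic A)) scale1r.
Qed.

Definition graph_eigenvalues (C : numClosedFieldType) (G : sgraph) : seq C :=
  eigenvalues (adjmx C G).

(* Main.v *)
(**
In an acyclic graph every permutation moving vertices along edges is an
involution, so the Leibniz expansion of det(xI - A) runs over the matchings s of
T: it equals the sum of (-1)^|s| x^(n - 2|s|). Evaluating at a square root of -2
gives prod (2 + alpha^2) = sum over s of 2^(n/2 - |s|); the eigenvalues are real,
nonzero (T has a perfect matching pi) and symmetric about 0.

A perfect matching of P_3 x T induces matchings m0, m1, m2 of T on the three
layers. As multisets of edges m0 + m2 = pi + m1, because their difference has
zero degree everywhere and T is acyclic. Hence, for a given m1 = s, the pair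
(m0, m2) amounts to a choice, for each component of the union of pi and s that is
not a common edge, of one of its two alternating colorings. That union is a
forest, so there are n/2 - |s| such components.
*)
Require Import Defs.
From HB Require Import structures.
From mathcomp Require Import all_boot all_order all_algebra fingroup perm.

Set Implicit Arguments.
Unset Strict Implicit.
Unset Printing Implicit Defensive.

Import Order.TTheory GRing.Theory Num.Theory.

Local Open Scope ring_scope.

(** * Graphs without cycles *)

Lemma adj_neq (G : sgraph) (x y : G) : adj x y -> x != y.
Proof. by apply: contraTneq => ->; rewrite adj_irrefl. Qed.

Section Acyclic.

Variables (G : sgraph) (acycG : acyclic G).

(** Closing a simple [e]-path from [x] to [y] by the edge [xy] gives a cycle of at least three
    vertices, because the path is not that edge alone. *)
Lemma acyclic_bridge (x y : G) (e : rel G) :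
  adj x y -> subrel e (@adj G) -> ~~ e x y -> ~~ connect e x y.
Proof.
move=> xy sub_e nexy; apply/negP => /connectP[p p_e yE].
case: (shortenP p_e) yE => q q_e q_uniq _ yE.
have /acycG : ucycle (@adj G) (x :: q).
  apply/andP; split=> //=.
  by rewrite rcons_path (sub_path sub_e q_e) /= -yE adj_sym.
case: q q_e q_uniq yE => [|z [|z' q]] //=.
  by move=> _ _ yx; rewrite yx adj_irrefl in xy.
by move=> /andP[exz _] _ yz; rewrite yz exz in nexy.
Qed.

(** A nonempty relation without leaves would let simple paths grow beyond the number of vertices. *)
Lemma acyclic_no_branching (r : rel G) :
    subrel r (@adj G) -> symmetric r ->
    (forall x y, r x y -> exists2 z, z != y & r x z) ->
  forall x y, ~~ r x y.
Proof.
move=> sub_r sym_r branch x y; apply/negP => rxy.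
have long n : exists x0 y0 p,
    [/\ path r x0 (y0 :: p), uniq (x0 :: y0 :: p) & size p = n].
  elim: n => [|n [x0 [y0 [p [p_r p_uniq p_size]]]]].
    exists x, y, [::]; split; rewrite /= ?rxy // inE andbT.
    exact: adj_neq (sub_r _ _ rxy).
  have r0 : r x0 y0 by case/andP: p_r.
  (* The path grows at its head: a second neighbor [z] of [x0] is either new, or lies on the path
     and then closes a cycle. *)
  have [z zy0 r0z] := branch _ _ r0.
  have zx0 : z != x0 by rewrite eq_sym; exact: adj_neq (sub_r _ _ r0z).
  have [zp | zNp] := boolP (z \in p); last first.
    exists z, x0, (y0 :: p); split; last by rewrite /= p_size.
      by rewrite /= sym_r r0z.
    by rewrite cons_uniq p_uniq !inE !negb_or zx0 zy0 zNp.
  exfalso; case/splitPr: zp p_r p_uniq {p_size} => p1 p2 p_r p_uniq.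
  have /acycG : ucycle (@adj G) (x0 :: y0 :: rcons p1 z).
    apply/andP; split.
      have: path r x0 (rcons (y0 :: rcons p1 z) x0).
        rewrite rcons_path -cat_rcons -cat_cons cat_path in p_r *.
        case/andP: p_r => -> _ /=.
        by rewrite last_rcons sym_r.
      exact: sub_path.
    rewrite -cat_rcons -!cat_cons cat_uniq in p_uniq.
    by case/andP: p_uniq.
  by rewrite /= size_rcons.
have [x0 [y0 [p [_ p_uniq p_size]]]] := long #|G|.
have := max_card (mem (x0 :: y0 :: p)).
by rewrite (card_uniqP p_uniq) /= p_size ltnNge leqnSn.
Qed.

(** An orbit with at least three vertices would be a cycle of the graph. *)
Lemma acyclic_inj_involutive (s : G -> G) : injective s ->
  (forall x, (s x == x) || adj x (s x)) -> involutive s.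
Proof.
move=> s_inj s_adj x; apply/eqP/negPn/negP => ssx.
have sub_s y : y \in orbit s x -> adj y (s y).
  rewrite -fconnect_orbit => /iter_findex <-; set n := findex _ _ _.
  have /predU1P[] // := s_adj (iter n s x).
  (* By injectivity, a fixed iterate would make [x] itself fixed. *)
  suff: s (iter n s x) = iter n s x -> s x = x.
    by move=> /[apply] sx; rewrite !sx eqxx in ssx.
  by elim: n => //= n IHn /s_inj.
have /acycG : ucycle (@adj G) (orbit s x).
  rewrite /ucycle orbit_uniq andbT.
  apply: (sub_in_cycle (e := frel s) (P := mem (orbit s x))).
  - by move=> y z /sub_s yP _ /eqP <-.
  - exact/allP.
  - exact: (cycle_orbit s_inj).
rewrite size_orbit ltnNge => /negP; apply.
have: uniq [:: x; s x; s (s x)].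
  rewrite /= !inE negb_or eq_sym (inj_eq s_inj) andbT.
  have sxx : s x != x by apply: contra ssx => /eqP sx; rewrite !sx.
  by rewrite sxx eq_sym ssx eq_sym sxx.
move/card_uniqP => /= <-; rewrite -size_orbit -(card_uniqP (orbit_uniq s x)).
apply/subset_leq_card/subsetP => y; rewrite !inE -fconnect_orbit.
case/or3P => /eqP ->; rewrite ?connect0 ?fconnect1 //.
exact: connect_trans (fconnect1 _ _) (fconnect1 _ _).
Qed.

End Acyclic.

(** * Perfect matchings as fixed-point-free involutions *)

Lemma card_cancel (aT rT : finType) (A : {pred aT}) (B : {pred rT})
    (f : aT -> rT) (g : rT -> aT) :
    {in A, forall x, f x \in B} -> {in B, forall y, g y \in A} ->
    {in A, cancel f g} -> {in B, cancel g f} ->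
  #|A| = #|B|.
Proof.
move=> fB gA fK gK; rewrite -(card_in_image (can_in_inj fK)).
apply: eq_card => y; apply/imageP/idP => [[x xA ->] | yB]; first exact: fB.
by exists (g y); [exact: gA | rewrite gK].
Qed.

Section PerfectMatching.

Variable G : sgraph.

(** A perfect matching is encoded by the map sending each vertex to its partner. *)
Definition mates : {set {ffun G -> G}} :=
  [set f : {ffun G -> G} | [forall x, adj x (f x) && (f (f x) == x)]].

Lemma matesP (f : {ffun G -> G}) :
  reflect ((forall x, adj x (f x)) /\ involutive f) (f \in mates).
Proof.
rewrite inE; apply: (iffP forallP) => [f_mate | [f_adj fK] x].
  by split=> x; have /andP[fx /eqP] := f_mate x.
by rewrite f_adj fK eqxx.
Qed.

Lemma mem_edges (x y : G) : ([set x; y] \in edges G) = adj x y.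
Proof.
apply/imset2P/idP => [[a b _] | xy]; last by exists x y; rewrite ?inE.
rewrite inE => /andP[_ ab] xyE; have ab_neq := adj_neq ab.
have: (a \in [set x; y]) && (b \in [set x; y]) by rewrite xyE !inE !eqxx orbT.
rewrite !inE => /andP[/orP[]/eqP aE /orP[]/eqP bE]; subst a b => //.
- by rewrite eqxx in ab_neq.
- by rewrite adj_sym.
- by rewrite eqxx in ab_neq.
Qed.

Definition matching_of (f : {ffun G -> G}) : {set {set G}} :=
  [set [set x; f x] | x : G].

(** The default [x] is a dummy: for a perfect matching the search succeeds and its result is
    unique. *)
Definition mate_of (M : {set {set G}}) : {ffun G -> G} :=
  [ffun x => odflt x [pick y | [set x; y] \in M]].

Lemma mem_matching_of f x y :
  f \in mates -> ([set x; y] \in matching_of f) = (y == f x).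
Proof.
move=> /matesP[f_adj fK]; apply/imsetP/eqP => [[z _ xyE] | ->]; last by exists x.
have xy : adj x y by rewrite -mem_edges xyE mem_edges.
have: (x \in [set z; f z]) && (y \in [set z; f z]).
  by rewrite -xyE !inE !eqxx orbT.
have xy_neq := adj_neq xy.
rewrite !inE => /andP[/orP[]/eqP xE /orP[]/eqP yE]; subst x y => //.
  by rewrite eqxx in xy_neq.
by rewrite eqxx in xy_neq.
Qed.

Lemma matching_of_perfect f : f \in mates -> perfect_matching (matching_of f).
Proof.
move=> f_mate; have [f_adj fK] := matesP f f_mate.
apply/andP; split.
  by apply/subsetP => _ /imsetP[x _ ->]; rewrite mem_edges.
apply/forallP => x; apply/cards1P; exists [set x; f x].
apply/setP => A; rewrite !inE; apply/andP/eqP => [[/imsetP[y _ ->]]|->].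
  by rewrite !inE => /orP[]/eqP ->; rewrite ?fK // setUC.
by rewrite mem_matching_of // !inE !eqxx.
Qed.

Lemma mate_of_uniq (M : {set {set G}}) (x y : G) :
  perfect_matching M -> [set x; y] \in M -> mate_of M x = y.
Proof.
move=> /andP[/subsetP M_edges /forallP/(_ x)/cards1P[A MxE]] xyM; rewrite ffunE.
case: pickP => [z xzM | /(_ y)]; last by rewrite xyM.
have inA B : B \in M -> x \in B -> B = A.
  by move=> BM xB; apply/set1P; rewrite -MxE inE BM.
have xzxy : [set x; z] = [set x; y].
  by apply: (etrans (inA _ xzM _) (esym (inA _ xyM _))); exact: set21.
have: z \in [set x; y] by rewrite -xzxy !inE eqxx orbT.
have := M_edges _ xzM; rewrite mem_edges => /adj_neq xz.
by rewrite !inE eq_sym (negPf xz) => /eqP.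
Qed.

Lemma mate_ofP (M : {set {set G}}) (x : G) :
  perfect_matching M -> [set x; mate_of M x] \in M.
Proof.
move=> /[dup] pmM /andP[/subsetP M_edges /forallP/(_ x)/cards1P[A MxE]].
have: A \in [set A in M | x \in A] by rewrite MxE set11.
rewrite inE => /andP[/[dup] AM /M_edges /imset2P[a b _ _ AE]].
rewrite {A MxE}AE in AM *; rewrite !inE => /orP[]/eqP ->.
  by rewrite (mate_of_uniq pmM AM).
by rewrite setUC in AM; rewrite (mate_of_uniq pmM AM).
Qed.

Lemma mate_of_mates (M : {set {set G}}) :
  perfect_matching M -> mate_of M \in mates.
Proof.
move=> pmM; have xM x := mate_ofP x pmM; apply/matesP; split=> x.
  by rewrite -mem_edges; case/andP: pmM => /subsetP-> //.
by apply: mate_of_uniq; rewrite // setUC.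
Qed.

Lemma Pm_card_mates : Pm G = #|mates|.
Proof.
apply: (card_cancel (f := mate_of) (g := matching_of)) => [M|f|M|f].
- by rewrite inE; exact: mate_of_mates.
- by move=> f_mate; rewrite inE; exact: matching_of_perfect.
- rewrite inE => pmM; apply/setP => A.
  apply/imsetP/idP => [[x _ ->] | AM]; first exact: mate_ofP.
  case/andP: (pmM) => /subsetP/(_ _ AM)/imset2P[a b _ _ AE _].
  by exists a; rewrite // AE; rewrite AE in AM; rewrite (mate_of_uniq pmM AM).
- move=> f_mate; apply/ffunP => x.
  apply: mate_of_uniq; first exact: matching_of_perfect.
  by rewrite mem_matching_of.
Qed.

End PerfectMatching.

(** * Superposition of matchings in a forest *)

Section Superposition.

Variable G : sgraph.

(** A fixed point stands for an uncovered vertex, so local involutions are the matchings, perfect or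
    not. *)
Definition local (f : G -> G) := forall x, (f x == x) || adj x (f x).

(* The difference of the two sides is a symmetric matrix supported on edges
   with zero row sums, so its support has no leaf. *)
Lemma acyclic_superposition (f g h k : G -> G) : acyclic G ->
    involutive f -> involutive g -> involutive h -> involutive k ->
    local f -> local g -> local h -> local k ->
    (forall x, (f x == x) + (g x == x) = (h x == x) + (k x == x))%N ->
  forall x y, ((f x == y) + (g x == y) = (h x == y) + (k x == y))%N.
Proof.
move=> acycG fK gK hK kK f_loc g_loc h_loc k_loc diag.
pose D x y : int := (f x == y)%:R + (g x == y)%:R - ((h x == y)%:R + (k x == y)%:R).
have D0E x y : (D x y == 0) =
    ((f x == y) + (g x == y) == (h x == y) + (k x == y))%N.
  by rewrite /D subr_eq0 -!natrD eqr_nat.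
have sym_inv (m : G -> G) x y : involutive m -> (m x == y) = (m y == x).
  by move=> mK; rewrite (can2_eq mK mK) eq_sym.
have loc_adj (m : G -> G) x y : local m -> x != y -> ~~ adj x y -> (m x == y) = false.
  move=> m_loc xy xNy; apply: contraNF xNy => /eqP mxy; move: xy; rewrite -mxy.
  by have /predU1P[->|//] := m_loc x; rewrite eqxx.
suff D0 x y : ~~ (D x y != 0) by move=> x y; have := D0 x y; rewrite negbK D0E => /eqP.
apply: (acyclic_no_branching acycG (r := fun x y => D x y != 0)) => {}x {}y.
- apply: contraR => xNy; rewrite D0E.
  have [<- | xy] := eqVneq x y; first by rewrite diag.
  by rewrite !loc_adj.
- by rewrite /D ![_ x == y]sym_inv.
(* If all other entries of row [x] vanish, the zero row sum makes [D x y] vanish as well. *)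
move=> Dxy; apply/exists_inP; apply: contraR Dxy => /exists_inPn Dx.
have: \sum_z D x z = 0.
  have sum1 (m : G -> G) : \sum_z (m x == z)%:R = 1 :> int.
    rewrite (bigD1 (m x)) //= eqxx big1 ?addr0 // => z.
    by rewrite eq_sym => /negPf ->.
  by rewrite sumrB !big_split /= !sum1 subrr.
rewrite (bigD1 y) //= big1 ?addr0 => [->|z] //.
by move/Dx/negPn/eqP.
Qed.

End Superposition.

(** Row [x] of the identity says that the pairs [f x, g x] and [h x, k x] agree as multisets. *)
Lemma superposition_cases (G : sgraph) (f g h k : G -> G) :
    (forall x y, ((f x == y) + (g x == y) = (h x == y) + (k x == y))%N) ->
  forall x, f x = h x /\ g x = k x \/ f x = k x /\ g x = h x.
Proof.
move=> fghk x; have := fghk x (h x); rewrite eqxx.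
have [fhx _ | fhx] := eqVneq (f x) (h x).
  left; split=> //; have := fghk x (g x).
  by rewrite fhx eqxx => /eqP; rewrite eqn_add2l; case: (k x =P g x).
have [ghx _ | //] := eqVneq (g x) (h x).
right; split=> //; have := fghk x (f x).
rewrite ghx eqxx addnC => /eqP.
by rewrite eqn_add2l; case: (k x =P f x).
Qed.

(** * Counting with involutions and with linear constraints over F_2 *)

Lemma mem_imset_inv (X : finType) (f : X -> X) (A : {set X}) x :
  involutive f -> (x \in f @: A) = (f x \in A).
Proof. by move=> fK; rewrite (can2_imset_pre _ fK fK) inE. Qed.

(** One end of each moved pair [x, f x] has the smaller rank; these ends and their images partition
    the moved points. *)
Lemma card_reps (X : finType) (f : X -> X) : involutive f ->
  (#|[set x | enum_rank x < enum_rank (f x)]|.*2 = #|[set x | f x != x]|)%N.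
Proof.
move=> fK; set R := [set x | _].
have -> : [set x | f x != x] = R :|: f @: R.
  apply/setP => x; rewrite !inE (mem_imset_inv _ _ fK) inE fK -neq_ltn.
  by rewrite (inj_eq val_inj) (inj_eq enum_rank_inj) eq_sym.
rewrite cardsU card_imset; last exact: can_inj fK.
rewrite (_ : R :&: _ = set0) ?cards0 ?subn0 ?addnn //.
apply/setP => x; rewrite !inE (mem_imset_inv _ _ fK) inE fK.
by apply/negbTE; rewrite negb_and -!leqNgt leq_total.
Qed.

(* Over F_2, functionals [ell i] admitting a dual family [w] are independent. *)
Lemma card_dual_family (J X : finType) (ell : J -> {ffun X -> bool} -> bool)
    (w : J -> {ffun X -> bool}) (s : seq J) :
    (forall i (c d : {ffun X -> bool}), ell i [ffun x => c x (+) d x] = ell i c (+) ell i d) ->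
    uniq s -> {in s &, forall i j, ell i (w j) = (i == j)} ->
  (#|[set c | all (fun i => ~~ ell i c) s]| * 2 ^ size s = 2 ^ #|X|)%N.
Proof.
move=> ellD; elim: s => [_ _ | j s IH] /=.
  by rewrite muln1 cardsT card_ffun card_bool.
move=> /andP[jNs s_uniq] dual.
rewrite expnS mulnA -(IH s_uniq); last first.
  by move=> i k si sk; apply: dual; rewrite inE ?si ?sk orbT.
congr (_ * _)%N; set S := [set c | all _ s].
(* Translation by [w j] flips [ell j] and preserves the other constraints, so it exchanges the two
   halves of [S]. *)
pose t (c : {ffun X -> bool}) : {ffun X -> bool} := [ffun x => c x (+) w j x].
have tK : involutive t by move=> c; apply/ffunP => x; rewrite !ffunE addbK.
have jt c : ell j (t c) = ~~ ell j c.
  by rewrite ellD dual ?mem_head // eqxx addbT.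
have st c : (t c \in S) = (c \in S).
  rewrite !inE; apply: eq_in_all => i si; rewrite ellD dual ?mem_head //.
    by rewrite (_ : i == j = false) ?addbF //; apply: contraNF jNs => /eqP <-.
  by rewrite inE si orbT.
set A := [set c | _]; have AE c : (c \in A) = ~~ ell j c && (c \in S).
  by rewrite !inE.
have -> : S = A :|: t @: A.
  apply/setP => c; rewrite in_setU (mem_imset_inv _ _ tK) !AE jt st.
  by case: (ell j c); rewrite ?orbF.
rewrite cardsU card_imset; last exact: can_inj tK.
rewrite (_ : A :&: _ = set0) ?cards0 ?subn0 ?muln2 ?addnn //.
apply/setP => c; rewrite in_setI in_set0 (mem_imset_inv _ _ tK) !AE jt.
by case: (ell j c); rewrite ?andbF.
Qed.

(** * Alternating colorings of two superposed matchings *)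

Section Colorings.

Variables (G : sgraph) (acycG : acyclic G) (pi sg : G -> G).
Hypotheses (piK : involutive pi) (sgK : involutive sg).
Hypotheses (pi_adj : forall x, adj x (pi x)) (sg_loc : local sg).

(* [c x] tells that the [pi]-edge at [x] belongs to the top layer and the
   [sg]-edge to the bottom one; where both coincide the choice is immaterial and
   [c x] is normalized to [false]. *)
Definition colorings : {set {ffun G -> bool}} :=
  [set c : {ffun G -> bool} | [forall x, (c (pi x) == c x) &&
     (if sg x == pi x then ~~ c x else c (sg x) == c x)]].

Let mate (b : bool) := if b then sg else pi.
Let dbl x := sg x == pi x.

Let mateK b : involutive (mate b). Proof. by case: b. Qed.

Let dbl_mate b x : dbl (mate b x) = dbl x.
Proof.
rewrite /dbl; case: b => /=; first by rewrite sgK eq_sym (can2_eq piK piK).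
by rewrite piK (can2_eq sgK sgK) eq_sym.
Qed.

Let cut (x z : G) : rel G := fun u v =>
  [&& adj u v, (v == pi u) || (v == sg u)
    & ~~ ((u == x) && (v == z) || (u == z) && (v == x))].

Let cut_sym x z : symmetric (cut x z).
Proof.
move=> u v; rewrite /cut adj_sym; congr [&& _, _ & ~~ _].
  by rewrite eq_sym (can2_eq piK piK) [v == _]eq_sym (can2_eq sgK sgK).
by rewrite orbC andbC [(u == x) && _]andbC.
Qed.

Let pt (b : bool) x := if b then pi x else x.

(** Away from common edges the constraint equates the colors along a [pi]- or [sg]-edge. On a common
    edge the two values of [i.1] make the color vanish at its two ends. *)
Let ell (i : bool * G) (c : {ffun G -> bool}) :=
  if dbl i.2 then c (pt i.1 i.2) else c i.2 (+) c (mate i.1 i.2).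

(* Components of the union of [pi] and [sg] with one edge removed: acyclicity
   makes them a basis dual to the constraints [ell]. *)
Let witness (i : bool * G) : {ffun G -> bool} :=
  [ffun y => if dbl i.2 then y == pt i.1 i.2
             else connect (cut i.2 (mate i.1 i.2)) i.2 y].

(** Every edge of each matching is listed once, from its end of smaller rank; a common edge is thus
    listed twice. *)
Let reps := [set i : bool * G | enum_rank i.2 < enum_rank (mate i.1 i.2)]%N.

Let rep_adj b x : (b, x) \in reps -> adj x (mate b x).
Proof.
rewrite inE /=; case: b => /= [|_]; last exact: pi_adj.
by have /predU1P[->|//] := sg_loc x; rewrite ltnn.
Qed.

Let rep_nonrep b x : (b, x) \in reps -> (b, mate b x) \notin reps.
Proof. by rewrite !inE /= mateK -leqNgt; apply: ltnW. Qed.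

Let ndbl_eq b b' x : ~~ dbl x -> mate b x = mate b' x -> b = b'.
Proof. by rewrite /dbl; case: b b' => -[] //= /eqP // sx /esym. Qed.

Let dbl_pt b x : dbl (pt b x) = dbl x.
Proof. by case: b => //=; rewrite (dbl_mate false). Qed.

Let dbl_rep b x : dbl x -> (b, x) \in reps ->
  (enum_rank x < enum_rank (pi x))%N.
Proof. by rewrite inE /= /dbl => /eqP sx; case: b; rewrite //= sx. Qed.

Let connect_dbl x z u v : connect (cut x z) u v -> dbl u = dbl v.
Proof.
apply: (closed_connect (a := dbl)) => {}u {}v /and3P[_ /orP[]/eqP -> _].
  exact: (esym (dbl_mate false u)).
exact: (esym (dbl_mate true u)).
Qed.

(** The removed edge is listed by no other index: its two matchings differ at [x], and its reverse
    orientation is not a representative. *)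
Let cut_mate b b' x y : (b, y) \in reps -> (b', x) \in reps -> ~~ dbl x ->
  (b, y) != (b', x) -> cut x (mate b' x) y (mate b y).
Proof.
move=> yR xR x_ndbl yx; rewrite /cut rep_adj //=; apply/andP; split.
  by case: (b); rewrite eqxx ?orbT.
apply: contra yx; rewrite xpair_eqE => /orP[]/andP[/eqP yE].
  by rewrite yE => /eqP/(ndbl_eq x_ndbl) ->; rewrite !eqxx.
rewrite (can2_eq (mateK b) (mateK b)) yE => /eqP/(ndbl_eq x_ndbl) bb.
by move: yR; rewrite yE -bb (negPf (rep_nonrep _)) // bb.
Qed.

(** Removing a bridge separates its own ends, while every other listed edge survives the cut and
    keeps its ends in one component. On common edges the witness is the indicator of a single
    vertex. *)
Let dual : {in reps &, forall i j, ell i (witness j) = (i == j)}.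
Proof.
move=> [b y] [b' x] yR xR; rewrite /ell /witness /=.
have dblN u v : ~~ dbl u -> dbl v -> (u == v) = false.
  by move=> uN vD; apply: contraNF uN => /eqP ->.
have [y_dbl | y_ndbl] := boolP (dbl y); rewrite !ffunE /=;
  have [x_dbl | x_ndbl] := boolP (dbl x).
- have := (dbl_rep y_dbl yR, dbl_rep x_dbl xR).
  case: (b) (b') => -[] [y_lt x_lt]; rewrite /= xpair_eqE //=.
  + by rewrite (can_eq piK).
  + apply: contraTF y_lt => /eqP pyx.
    by rewrite pyx -leqNgt -[y]piK pyx ltnW.
  + apply: contraTF x_lt => /eqP ypx.
    by rewrite -ypx -leqNgt -[x]piK -ypx ltnW.
- rewrite xpair_eqE [y == x]eq_sym dblN // andbF; apply: contraNF x_ndbl.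
  by move/connect_dbl ->; rewrite dbl_pt.
- by rewrite xpair_eqE !dblN ?dbl_mate ?dbl_pt // andbF.
have [[-> ->] | yx] := eqVneq (b, y) (b', x).
  rewrite connect0 /=; apply: (acyclic_bridge acycG); first exact: rep_adj.
    by move=> u v /andP[].
  by rewrite /cut !eqxx !andbF.
have cut_csym := sym_connect_sym (@cut_sym x (mate b' x)).
rewrite (same_connect_r cut_csym (connect1 (cut_mate yR xR x_ndbl yx))).
exact: addbb.
Qed.

(** The colorings solve one independent F_2-constraint per edge of [pi] and per edge of [sg], in
    [#|G|] unknowns; a factor [2 ^ #|G|./2] then cancels. *)
Lemma card_colorings :
  (#|colorings| * 2 ^ #|[set x | sg x != x]|./2 = 2 ^ #|G|./2)%N.
Proof.
pose R b := [set x | enum_rank x < enum_rank (mate b x)]%N.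
have cardR : (#|reps| = #|R true| + #|R false|)%N.
  have -> : reps = setX [set true] (R true) :|: setX [set false] (R false).
    by apply/setP => -[[] x]; rewrite !inE /= ?andbF ?orbF.
  rewrite cardsU !cardsX !cards1 !mul1n (_ : _ :&: _ = set0) ?cards0 ?subn0 //.
  by apply/setP => -[[] x]; rewrite !inE /= ?andbF.
have sizeR b : #|R b| = #|[set x | mate b x != x]|./2.
  by rewrite -card_reps // doubleK.
have moved_pi : #|[set x | mate false x != x]| = #|G|.
  rewrite -cardsT; apply: eq_card => x.
  by rewrite !inE eq_sym (adj_neq (pi_adj x)).
(* The constraints are symmetric in the ends of an edge and void at fixed points of [sg], so
   representatives suffice. *)
have colE : colorings = [set c | all (fun i => ~~ ell i c) (enum reps)].
  apply/setP => c; rewrite !inE; apply/forallP/allP => [c_col [b x] _ | c_ell x].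
    rewrite /ell /=; have /andP[/eqP cpi] := c_col x.
    case: ifP => [dx | ndx /eqP csg]; last first.
      by rewrite /dbl ndx; case: b => /=; rewrite ?csg ?cpi addbb.
    by rewrite /dbl dx; case: b; rewrite //= cpi.
  have ell_lt b y : (enum_rank y < enum_rank (mate b y))%N -> ~~ ell (b, y) c.
    by move=> lt_y; rewrite c_ell // mem_enum inE.
  have ltP b y : y != mate b y -> (enum_rank y < enum_rank (mate b y))%N \/
      (enum_rank (mate b y) < enum_rank y)%N.
    by move=> yN; apply/orP; rewrite -neq_ltn (inj_eq val_inj) (inj_eq enum_rank_inj).
  have [dx | ndx] := boolP (dbl x).
    have dbl_lt y : dbl y -> (enum_rank y < enum_rank (pi y))%N ->
        ~~ c y && ~~ c (pi y).
      move=> dy lt_y; have := ell_lt false y lt_y.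
      have := ell_lt true y; rewrite /ell /= dy (eqP dy) => /(_ lt_y) -> -> //.
    rewrite -/(dbl x) dx; have := ltP false x (adj_neq (pi_adj x)).
    case=> [/(dbl_lt x dx)/andP[/negPf -> /negPf ->] // | lt_x].
    have := dbl_lt (pi x); rewrite (dbl_mate false x) piK.
    by case/(_ dx lt_x)/andP => /negPf -> /negPf ->.
  rewrite -/(dbl x) (negPf ndx).
  have eq_mate b : c (mate b x) == c x.
    have [<- // | /ltP] := eqVneq x (mate b x).
    case=> lt_x.
      have := ell_lt b x lt_x; rewrite /ell /= (negPf ndx) negb_add.
      by rewrite eq_sym.
    have := ell_lt b (mate b x); rewrite mateK => /(_ lt_x).
    by rewrite /ell /= dbl_mate (negPf ndx) mateK negb_add.
  by rewrite (eq_mate false) (eq_mate true).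
have ellD i (c d : {ffun G -> bool}) : ell i [ffun x => c x (+) d x] = ell i c (+) ell i d.
  by rewrite /ell !ffunE; case: ifP => // _; rewrite addbACA.
have evenG : (#|G| = #|G|./2 + #|G|./2)%N.
  by rewrite addnn -moved_pi -card_reps // doubleK.
have: (#|colorings| * 2 ^ #|reps| = 2 ^ #|G|)%N.
  rewrite colE [#|reps|]cardE; apply: (card_dual_family (w := witness) ellD (enum_uniq reps)).
  by move=> i j; rewrite !mem_enum; exact: dual.
rewrite cardR !sizeR moved_pi {2}evenG !expnD mulnA => /eqP.
by rewrite eqn_pmul2r ?expn_gt0 // => /eqP.
Qed.

End Colorings.

(** * Perfect matchings of the product, layer by layer *)

Section PathProduct.

Variables (T : sgraph) (acycT : acyclic T) (pi : T -> T).
Hypotheses (piK : involutive pi) (pi_adj : forall x, adj x (pi x)).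

Definition matchings : {set {ffun T -> T}} :=
  [set s : {ffun T -> T} |
    [forall x, ((s x == x) || adj x (s x)) && (s (s x) == x)]].

Lemma matchingsP (s : {ffun T -> T}) :
  reflect (local s /\ involutive s) (s \in matchings).
Proof.
rewrite inE; apply: (iffP forallP) => [s_match | [s_loc sK] x].
  by split=> x; have /andP[sx /eqP] := s_match x.
by rewrite s_loc sK eqxx.
Qed.

Let P3T := cart_prod (path_graph 3) T.

Let i0 : 'I_3 := Ordinal (isT : 0 < 3)%N.
Let i1 : 'I_3 := Ordinal (isT : 1 < 3)%N.
Let i2 : 'I_3 := Ordinal (isT : 2 < 3)%N.

Let ord3P (i : 'I_3) : [\/ i = i0, i = i1 | i = i2].
Proof.
case: i => [[|[|[|i]]] lt_i] //; [constructor 1 | constructor 2 | constructor 3];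
  exact: val_inj.
Qed.

(** Only the coordinate in [T] is kept, so a vertex matched vertically becomes a fixed point. *)
Let layer (f : {ffun P3T -> P3T}) (i : 'I_3) : T -> T := fun v => (f (i, v)).2.

Section Layers.

Variables (f : {ffun P3T -> P3T}) (f_mate : f \in mates P3T).

Let fK : involutive f. Proof. by case/matesP: f_mate. Qed.

Let layer_spec i v :
  f (i, v) = (i, layer f i v) /\ adj v (layer f i v) \/
  path_adj i (f (i, v)).1 /\ layer f i v = v.
Proof.
case/matesP: f_mate => /(_ (i, v)) /=; rewrite /cart_adj /layer /=.
by case: (f _) => j w /= /orP[/andP[/eqP -> vw] _ | /andP[ij /eqP ->]]; [left | right].
Qed.

Lemma layer_local i : local (layer f i).
Proof.
by move=> v; case: (layer_spec i v) => [[_ ->]|[_ ->]]; rewrite ?eqxx ?orbT.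
Qed.

Lemma layerK i : involutive (layer f i).
Proof.
move=> v; case: (layer_spec i v) => [[fE _]|[_ fE]]; last by rewrite !fE.
by rewrite {1}/layer -fE fK.
Qed.

Lemma layer_horizontal i v : layer f i v != v -> f (i, v) = (i, layer f i v).
Proof. by case: (layer_spec i v) => [[]|[_ ->]] //; rewrite eqxx. Qed.

Let layer_vertical i v : layer f i v = v -> path_adj i (f (i, v)).1.
Proof.
by case: (layer_spec i v) => [[_ /adj_neq /negPf vN]|[]] // /esym/eqP; rewrite vN.
Qed.

Let layer_fix i j v : f (i, v) = (j, v) -> layer f i v = v.
Proof. by rewrite /layer => ->. Qed.

Lemma layer_bottom v : layer f i0 v = v -> f (i0, v) = (i1, v).
Proof.
move=> /[dup] /layer_vertical; rewrite /layer; case: (f _) => j w /= + ->.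
by case: (ord3P j) => ->.
Qed.

Lemma layer_top v : layer f i2 v = v -> f (i2, v) = (i1, v).
Proof.
move=> /[dup] /layer_vertical; rewrite /layer; case: (f _) => j w /= + ->.
by case: (ord3P j) => ->.
Qed.

Lemma layer_middle v : layer f i1 v = v ->
  f (i1, v) = if layer f i0 v == v then (i0, v) else (i2, v).
Proof.
move=> /[dup] /layer_vertical; case: eqP => [/layer_bottom f0 | f0].
  by move=> _ _; rewrite -f0 fK.
rewrite /layer; case E: (f _) => [j w] /= + wv; subst w.
case: (ord3P j) => jE //; subst j => // _; case: f0.
by rewrite /layer -E fK.
Qed.

(** Every vertical edge over [v] joins the middle copy to one outer copy, so the outer layers
    together fix [v] as often as the middle one; [pi] fixes nothing. This is the diagonal condition
    of the superposition lemma. *)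
Lemma layer_fixE v : ((layer f i0 v == v) + (layer f i2 v == v) =
  (pi v == v) + (layer f i1 v == v))%N.
Proof.
rewrite [pi v == v]eq_sym (negPf (adj_neq (pi_adj v))).
have [m1 | m1] := eqVneq (layer f i1 v) v.
  have := layer_middle m1; case: eqP => [/layer_bottom m0 f1 | m0 f1].
    case: eqP => // /layer_top; rewrite -m0 => /(can_inj fK) //.
  by rewrite (_ : layer f i2 v = v) ?eqxx // /layer -f1 fK.
have NN i : f (i, v) = (i1, v) -> False.
  move=> fi; case/eqP: m1; apply: (layer_fix (j := i)).
  by rewrite -fi fK.
case: eqP => [/layer_bottom/NN // | _].
by case: eqP => [/layer_top/NN|].
Qed.

Lemma layer_cases v :
  layer f i0 v = pi v /\ layer f i2 v = layer f i1 v \/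
  layer f i0 v = layer f i1 v /\ layer f i2 v = pi v.
Proof.
apply: (superposition_cases (f := layer f i0) (g := layer f i2)).
apply: acyclic_superposition acycT _ _ _ _ _ _ _ _ layer_fixE => //;
  try exact: layerK; try exact: layer_local.
by move=> x; rewrite pi_adj orbT.
Qed.

End Layers.

(** Where the middle layer of a perfect matching agrees with [pi], so does the bottom one, and the
    color is [false] as the normalization demands. *)
Definition decode (f : {ffun P3T -> P3T}) : {ffun T -> T} * {ffun T -> bool} :=
  ([ffun v => layer f i1 v], [ffun v => layer f i0 v != pi v]).

(** A vertex fixed in its layer is matched vertically; in the middle it goes to the outer layer that
    carries [s] there. *)
Definition encode (sc : {ffun T -> T} * {ffun T -> bool}) : {ffun P3T -> P3T} :=
  [ffun u : P3T =>
    let: (i, v) := u in let: (s, c) := sc in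
    let m0 := if c v then s v else pi v in
    let m2 := if c v then pi v else s v in
    if i == i0 then if m0 == v then (i1, v) else (i0, m0)
    else if i == i2 then if m2 == v then (i1, v) else (i2, m2)
    else if s v == v then (if c v then i0 else i2, v) else (i1, s v)].

Definition colored_matchings : {set {ffun T -> T} * {ffun T -> bool}} :=
  [set sc : {ffun T -> T} * {ffun T -> bool} |
    (sc.1 \in matchings) && (sc.2 \in colorings pi sc.1)].

Lemma decode_colored : {in mates P3T, forall f, decode f \in colored_matchings}.
Proof.
move=> f f_mate; have mK i := layerK f_mate i.
rewrite inE; apply/andP; split => /=.
  apply/matchingsP; split=> v; rewrite !ffunE; first exact: layer_local.
  exact: mK.
rewrite inE; apply/forallP => v; rewrite !ffunE piK; apply/andP; split.
  by rewrite (can2_eq (mK i0) (mK i0)) [_ == layer f i0 v]eq_sym.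
have cases := layer_cases f_mate v.
case: ifP => [/eqP dv | /negbT dv].
  by rewrite negbK; case: cases => -[-> _]; rewrite ?dv.
case: cases => -[m0 _]; rewrite m0 ?eqxx; last first.
  by rewrite -{1}m0 mK dv [v == _]eq_sym (can2_eq piK piK) dv.
(* Here the bottom layer follows [pi] at [v]. If it followed the middle layer at the middle partner
   of [v], it would return to [v], so [pi] and the middle layer would agree at [v]. *)
have := layer_cases f_mate (layer f i1 v); rewrite mK.
case=> -[m01 _]; rewrite ?m01 ?eqxx //.
by case/eqP: dv; rewrite -m0 -[in RHS]m01 mK.
Qed.

Section Encode.

Variables (s : {ffun T -> T}) (c : {ffun T -> bool}).
Hypothesis sc_colored : (s, c) \in colored_matchings.

Let s_loc : local s.
Proof. by move: sc_colored; rewrite inE => /andP[/matchingsP[]]. Qed.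

Let sK : involutive s.
Proof. by move: sc_colored; rewrite inE => /andP[/matchingsP[]]. Qed.

Let c_col v : (c (pi v) == c v) && (if s v == pi v then ~~ c v else c (s v) == c v).
Proof. by move: sc_colored; rewrite inE => /andP[_]; rewrite inE => /forallP. Qed.

Let c_pi v : c (pi v) = c v. Proof. by have /andP[/eqP] := c_col v. Qed.

Let c_s v : c (s v) = c v.
Proof. by have /andP[_] := c_col v; case: eqP => [-> | _ /eqP]. Qed.

Let c_dbl v : c v -> s v != pi v.
Proof. by have /andP[_] := c_col v; case: eqP => // _ /negPf ->. Qed.

Let pi_neq v : (pi v == v) = false.
Proof. by rewrite eq_sym; apply/negbTE/adj_neq. Qed.

Lemma encode_bottom v : encode (s, c) (i0, v) =
  if c v && (s v == v) then (i1, v) else (i0, if c v then s v else pi v).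
Proof. by rewrite ffunE /=; case: (c v); rewrite ?pi_neq. Qed.

Lemma encode_top v : encode (s, c) (i2, v) =
  if ~~ c v && (s v == v) then (i1, v) else (i2, if c v then pi v else s v).
Proof. by rewrite ffunE /=; case: (c v); rewrite ?pi_neq. Qed.

Lemma encode_middle v : encode (s, c) (i1, v) =
  if s v == v then (if c v then i0 else i2, v) else (i1, s v).
Proof. by rewrite ffunE. Qed.

Lemma encode_mates : encode (s, c) \in mates P3T.
Proof.
have s_adj v : s v != v -> adj v (s v) by case/predU1P: (s_loc v) => [->|//]; rewrite eqxx.
apply/matesP; split=> -[i v].
  rewrite /= /cart_adj.
  case: (ord3P i) => ->; rewrite ?encode_bottom ?encode_top ?encode_middle.
  - by case cv: (c v); case: (eqVneq (s v) v) => //= sv; rewrite ?s_adj ?pi_adj ?eqxx.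
  - by case: (eqVneq (s v) v) => //= sv; [case: (c v); rewrite /= eqxx | rewrite s_adj].
  - by case cv: (c v); case: (eqVneq (s v) v) => //= sv; rewrite ?s_adj ?pi_adj ?eqxx.
case: (ord3P i) => ->; rewrite ?encode_bottom ?encode_top ?encode_middle.
- case cv: (c v); case: (eqVneq (s v) v) => //= sv.
  + by rewrite encode_middle sv eqxx cv.
  + by rewrite encode_bottom c_s cv sK eq_sym (negPf sv).
  + by rewrite encode_bottom c_pi cv piK.
  + by rewrite encode_bottom c_pi cv piK.
- case: (eqVneq (s v) v) => sv; last by rewrite encode_middle sK eq_sym (negPf sv).
  by case cv: (c v); rewrite ?encode_bottom ?encode_top cv sv eqxx.
- case cv: (c v); case: (eqVneq (s v) v) => //= sv.
  + by rewrite encode_top c_pi cv piK.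
  + by rewrite encode_top c_pi cv piK.
  + by rewrite encode_middle sv eqxx cv.
  + by rewrite encode_top c_s cv sK eq_sym (negPf sv).
Qed.

Lemma encodeK : decode (encode (s, c)) = (s, c).
Proof.
congr (_, _); apply/ffunP => v; rewrite ffunE /layer.
  by rewrite encode_middle; case: eqVneq => // ->.
rewrite encode_bottom; case cv: (c v) => /=; last by rewrite eqxx.
case: (eqVneq (s v) v) => [_ | _] /=; last exact: c_dbl.
by rewrite eq_sym pi_neq.
Qed.

End Encode.

Lemma decodeK : {in mates P3T, cancel decode encode}.
Proof.
move=> f f_mate; apply/ffunP => -[i v]; rewrite ffunE /= !ffunE.
have [m0 m2] : layer f i0 v = (if layer f i0 v != pi v then layer f i1 v else pi v)
    /\ layer f i2 v = (if layer f i0 v != pi v then pi v else layer f i1 v).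
  have := layer_cases f_mate v.
  case: (eqVneq (layer f i0 v) (pi v)) => [m0 | /eqP m0] /= [] [e0 e2] //.
  by rewrite e2 -m0.
rewrite -m0 -m2; case: (ord3P i) => -> /=.
- by case: eqP => [/(layer_bottom f_mate) -> | /eqP/(layer_horizontal f_mate) ->].
- case: eqVneq => [m1 | /(layer_horizontal f_mate) -> //].
  rewrite (layer_middle f_mate m1); move: m0; rewrite m1.
  by case: (eqVneq _ (pi v)) => /= [-> | _ ->]; rewrite ?eqxx // eq_sym (negPf (adj_neq _)).
- by case: eqP => [/(layer_top f_mate) -> | /eqP/(layer_horizontal f_mate) ->].
Qed.

Lemma Pm_path3 : Pm P3T = (\sum_(s in matchings) #|colorings pi s|)%N.
Proof.
rewrite Pm_card_mates.
rewrite (card_cancel decode_colored (g := encode)) => [|[s c]||[s c]]; last first.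
- exact: encodeK.
- exact: decodeK.
- exact: encode_mates.
under eq_bigr do rewrite -sum1_card.
by rewrite pair_big_dep -sum1_card; apply: eq_bigl => sc; rewrite inE.
Qed.

End PathProduct.

(** * The matching polynomial of a forest *)

(** Composing with the transposition of [x] and [s x] removes one moved pair and flips the
    parity. *)
Lemma odd_perm_involution (X : finType) (s : {perm X}) : involutive s ->
  ~~ odd #|[set x | s x != x]| /\ odd_perm s = odd #|[set x | s x != x]|./2.
Proof.
have [n] := ubnP #|[set x | s x != x]|; elim: n s => // n IHn s.
rewrite ltnS => le_n sK; set M := [set x | _] in le_n *.
have [M0 | [x]] := set_0Vmem M.
  have -> : s = 1%g.
    apply/permP => x; rewrite perm1; apply/eqP/negPn/negP => sx.
    by have := in_set0 x; rewrite -M0 inE sx.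
  by rewrite M0 cards0 odd_perm1.
rewrite inE => sx; pose t := (tperm x (s x) * s)%g.
have tE y : t y = if (y == x) || (y == s x) then y else s y.
  rewrite permM; case: tpermP => [->|->|/eqP/negPf -> /eqP/negPf -> //].
    by rewrite eqxx sK.
  by rewrite eqxx orbT.
have tK : involutive t.
  move=> y; rewrite tE [t y]tE.
  case: (boolP ((y == x) || (y == s x))) => [-> // | /norP[yx ysx]].
  by rewrite (can2_eq sK sK) (inj_eq perm_inj) (negPf yx) (negPf ysx) sK.
have sMx : s x \in M :\ x by rewrite !inE sx sK eq_sym.
have xM : x \in M by rewrite inE.
have MtE : [set y | t y != y] = M :\ x :\ s x.
  apply/setP => y; rewrite !inE tE.
  by case: (y == x) (y == s x) => -[]; rewrite ?eqxx ?andbF.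
have cardM : #|M| = #|[set y | t y != y]|.+2.
  by rewrite MtE (cardsD1 x M) xM (cardsD1 (s x) (M :\ x)) sMx.
have [|] := IHn t _ tK; first by rewrite cardM in le_n; apply: leq_trans le_n.
rewrite odd_mul_tperm eq_sym sx addTb cardM /= => ev tod.
by rewrite negbK ev -tod negbK.
Qed.

Section MatchingPolynomial.

Variables (T : sgraph) (acycT : acyclic T).

Definition moved (s : {ffun T -> T}) : {set T} := [set x | s x != x].

Lemma card_moved_even (s : {ffun T -> T}) :
  s \in matchings T -> (#|moved s|./2.*2)%N = #|moved s|.
Proof. by case/matchingsP => _ sK; rewrite -card_reps // doubleK. Qed.

Lemma det_sub_adjmx (R : comNzRingType) (x : R) :
  \det (x%:M - adjmx R T) =
  \sum_(s in matchings T) (-1) ^+ #|moved s|./2 * x ^+ (#|T| - #|moved s|).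
Proof.
pose h' (s : 'S_#|T|) : {ffun T -> T} := [ffun v => enum_val (s (enum_rank v))].
(* [h] inverts [h'] on injective maps; the identity given to [insubd] is a dummy for the others. *)
pose h (f : {ffun T -> T}) : 'S_#|T| :=
  insubd (1%g : 'S_#|T|) [ffun i => enum_rank (f (enum_val i))].
have hE (f : {ffun T -> T}) : injective f -> forall i, h f i = enum_rank (f (enum_val i)).
  move=> f_inj i; rewrite -pvalE val_insubd.
  rewrite ifT ?ffunE //; apply/injectiveP => j k; rewrite !ffunE.
  by move/enum_rank_inj/f_inj/enum_val_inj.
have h'_inj s : injective (h' s).
  by move=> u v; rewrite !ffunE => /enum_val_inj/perm_inj/enum_rank_inj.
have h'K s : h (h' s) = s.
  by apply/permP => i; rewrite hE // ffunE !enum_valK.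
have hK (f : {ffun T -> T}) : injective f -> h' (h f) = f.
  by move=> f_inj; apply/ffunP => v; rewrite ffunE hE // !enum_rankK.
rewrite /determinant (bigID (fun s => h' s \in matchings T)) /= [X in _ + X]big1.
  rewrite addr0 (reindex_onto h h') => [|s _]; last exact: h'K.
  apply: eq_big => [f | f /andP[+ /eqP hf]].
    apply/andP/idP => [[+ /eqP hf] | f_match]; first by rewrite hf.
    have /matchingsP[_ /inv_inj f_inj] := f_match.
    by rewrite hK // eqxx.
  rewrite hf => f_match; have ev := card_moved_even f_match.
  have /matchingsP[f_loc fK] := f_match; have hfE := hE f (inv_inj fK).
  have [|_ ->] := @odd_perm_involution _ (h f).
    by move=> i; rewrite !hfE enum_rankK fK enum_valK.
  have -> : [set i | h f i != i] = enum_rank @: moved f.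
    rewrite (can2_imset_pre _ (@enum_rankK _) (@enum_valK _)).
    by apply/setP => i; rewrite !inE hfE (can2_eq (@enum_rankK _) (@enum_valK _)).
  rewrite card_imset; last exact: enum_rank_inj.
  rewrite signr_odd; congr (_ * _).
  rewrite (reindex enum_rank) /=; last exact/onW_bij/enum_rank_bij.
  (* Moved vertices contribute -1 each and are even in number, so only the sign of the permutation
     and the powers of [x] survive. *)
  transitivity (\prod_v (if v \in moved f then -1 else x)).
    apply: eq_bigr => v _; rewrite !mxE hfE !enum_rankK (inj_eq enum_rank_inj).
    rewrite inE eq_sym; have := f_loc v.
    by case: eqVneq => /= [-> _ | _ ->]; rewrite ?adj_irrefl ?subr0 ?sub0r.
  rewrite (bigID (mem (moved f))) /= (eq_bigr (fun=> -1)) => [|v ->//].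
  rewrite prodr_const -ev -signr_odd odd_double mul1r.
  rewrite (eq_bigr (fun=> x)) => [|v /negPf -> //].
  rewrite prodr_const ev; congr (_ ^+ _); rewrite -(cardC (mem (moved f))).
  by rewrite addKn.
(* A permutation that is not a matching moves some vertex to a non-neighbor, where the matrix entry
   is zero. *)
move=> s sN; have [v vN] : exists v, ~~ ((h' s v == v) || adj v (h' s v)).
  apply/existsP; apply: contraNT sN => /existsPn s_loc.
  have loc : local (h' s) by move=> v; have := s_loc v; rewrite negbK.
  apply/matchingsP; split; first exact: loc.
  exact: (acyclic_inj_involutive acycT (@h'_inj s) loc).
rewrite (bigD1 (enum_rank v)) //= !mxE.
move: vN; rewrite ffunE negb_or => /andP[vN /negPf vNadj].
rewrite enum_rankK vNadj (_ : _ == _ = false) ?subr0 ?mul0r ?mulr0 //.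
by apply: contraNF vN => /eqP <-; rewrite enum_rankK.
Qed.

End MatchingPolynomial.

(** * Spectrum of a forest with a perfect matching *)

(** The Hermitian form [S] of [A] at an eigenvector is its own conjugate and equals [a] times the
    nonzero real [N]. *)
Lemma symmetric_eigenvalue_real (C : numClosedFieldType) (n : nat)
    (A : 'M[C]_n) (a : C) :
    A^T = A -> (forall i j, A i j \is Num.real) -> eigenvalue A a ->
  a \is Num.real.
Proof.
move=> symA realA /eigenvalueP[v vA v_neq0].
pose N := \sum_j v 0 j * (v 0 j)^*.
pose S := \sum_j (\sum_i v 0 i * A i j) * (v 0 j)^*.
have SE : S = a * N.
  rewrite mulr_sumr; apply: eq_bigr => j _.
  by rewrite mulrA; congr (_ * _); have /rowP/(_ j) := vA; rewrite !mxE.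
have S_real : S^* = S.
  rewrite rmorph_sum /=; under eq_bigr do rewrite rmorphM rmorph_sum mulr_suml.
  rewrite exchange_big /=; apply: eq_bigr => i _; rewrite mulr_suml.
  apply: eq_bigr => j _; rewrite rmorphM /= conjCK (CrealP (realA _ _)).
  by rewrite -{1}symA mxE [_^* * _]mulrC mulrAC [A _ _ * _]mulrC.
have N_real : N^* = N.
  rewrite rmorph_sum; apply: eq_bigr => j _.
  by rewrite rmorphM /= conjCK mulrC.
have N_neq0 : N != 0.
  rewrite psumr_neq0 => [|j _]; last exact: mul_conjC_ge0.
  have [j vj] : exists j, v 0 j != 0.
    apply/existsP; apply: contraNT v_neq0 => /existsPn v0.
    by apply/eqP/rowP => j; rewrite mxE; apply/eqP; have := v0 j; rewrite negbK.
  by apply/hasP; exists j; rewrite ?mem_index_enum //= mul_conjC_gt0.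
apply/CrealP/(mulIf N_neq0).
by rewrite -{1}N_real -rmorphM -SE /= S_real SE.
Qed.

Section TreeSpectrum.

Variables (C : numClosedFieldType) (T : sgraph) (acycT : acyclic T) (pi : T -> T).
Hypotheses (piK : involutive pi) (pi_adj : forall x, adj x (pi x)).

Let m := #|T|./2.
Let k (s : {ffun T -> T}) := #|moved s|./2.
Let eigs := graph_eigenvalues C T.

Let cardT : #|T| = m.*2.
Proof.
rewrite /m; have <- : #|[set x | pi x != x]| = #|T|.
  by rewrite -cardsT; apply: eq_card => x; rewrite !inE eq_sym (adj_neq (pi_adj x)).
by rewrite -card_reps // doubleK.
Qed.

Let card_fixed s : s \in matchings T -> (#|T| - #|moved s| = 2 * (m - k s))%N.
Proof. by move=> s_match; rewrite -card_moved_even // cardT -doubleB mul2n. Qed.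

(** As [#|T|] is even, the characteristic polynomial has only even exponents; [q] is that polynomial
    in the variable X^2. *)
Let q : {poly C} := \sum_(s in matchings T) (-1) ^+ k s *: 'X^(m - k s).

Let char_polyE : char_poly (adjmx C T) = q \Po 'X^2.
Proof.
have -> : char_poly (adjmx C T) = \det ('X%:M - adjmx {poly C} T).
  rewrite /char_poly /char_poly_mx; congr (\det (_ - _)).
  by apply/matrixP => i j; rewrite !mxE rmorph_nat.
rewrite det_sub_adjmx // /q rmorph_sum; apply: eq_bigr => s s_match.
rewrite /= comp_polyZ comp_Xn_poly card_fixed // exprM.
by rewrite -mul_polyC rmorphXn rmorphN1.
Qed.

Let hornerE_eigs x : q.[x ^+ 2] = \prod_(a <- eigs) (x - a).
Proof.
have -> : q.[x ^+ 2] = (char_poly (adjmx C T)).[x].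
  by rewrite char_polyE horner_comp hornerXn.
by rewrite char_poly_eigenvalues horner_prod; apply: eq_bigr => a _; rewrite hornerXsubC.
Qed.

Lemma eigenvalues_neq0 : 0 \notin eigs.
Proof.
have: q.[0 ^+ 2] != 0; last first.
  apply: contra => eigs0; rewrite hornerE_eigs prodf_seq_eq0.
  by apply/hasP; exists 0; rewrite //= subr0.
(* At 0 only the perfect matchings contribute, all with the same sign, and [pi] is one of them. *)
rewrite expr0n /= horner_sum (eq_bigr (fun s => (-1) ^+ m * (m <= k s)%:R)) => [|s _].
  rewrite -mulr_sumr mulf_neq0 ?signr_eq0 // -natr_sum pnatr_eq0 -lt0n.
  have pi_match : [ffun x => pi x] \in matchings T.
    by apply/matchingsP; split=> x; rewrite !ffunE ?pi_adj ?orbT.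
  rewrite (bigD1 _ pi_match) /= addn_gt0 lt0b /k.
  rewrite (_ : moved _ = setT) ?cardsT ?leqnn //.
  by apply/setP => x; rewrite !inE ffunE eq_sym (adj_neq (pi_adj x)).
have k_le : (k s <= m)%N by rewrite half_leq // max_card.
rewrite hornerZ hornerXn expr0n subn_eq0; case: leqP => [mk | _]; last by rewrite !mulr0.
by have -> : k s = m by apply/eqP; rewrite eqn_leq k_le.
Qed.

Lemma eigenvalues_real a : a \in eigs -> a \is Num.real.
Proof.
move=> a_eig; apply: (@symmetric_eigenvalue_real _ _ (adjmx C T)).
- by apply/matrixP => i j; rewrite !mxE adj_sym.
- by move=> i j; rewrite mxE realn.
by rewrite eigenvalue_root_char char_poly_eigenvalues root_prod_XsubC.
Qed.

(** The characteristic polynomial is invariant under X -> -X, and the signs taken out of its evenly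
    many linear factors cancel. *)
Lemma eigenvalues_sym : perm_eq eigs (map -%R eigs).
Proof.
apply: prod_XsubC_eq; rewrite big_map -char_poly_eigenvalues.
have -> : char_poly (adjmx C T) = char_poly (adjmx C T) \Po - 'X.
  by rewrite char_polyE -comp_polyA comp_Xn_poly sqrrN.
rewrite char_poly_eigenvalues rmorph_prod /=.
have size_eigs : size eigs = m.*2.
  have := size_char_poly (adjmx C T).
  by rewrite char_poly_eigenvalues size_prod_XsubC => -[]; rewrite -cardT.
rewrite (eq_bigr (fun a => (-1) * ('X - (- a)%:P))) => [|a _].
  by rewrite big_split /= big_const_seq count_predT size_eigs iter_mulr_1 -signr_odd
    odd_double mul1r.
by rewrite rmorphB /= comp_polyX comp_polyC rmorphN opprK mulN1r opprD.
Qed.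

Lemma prod_eigenvalues :
  \prod_(a <- eigs | 0 < a) (2 + a ^+ 2) =
  (\sum_(s in matchings T) 2 ^ (m - k s))%:R.
Proof.
set R := LHS; set N := (\sum_(s in _) _)%N.
have R_ge0 : 0 <= R.
  by apply: prodr_ge0 => a a_gt0; rewrite addr_ge0 // exprn_ge0 // ltW.
(* Both sides are nonnegative, and squaring turns the product over positive eigenvalues into one
   over all. *)
suff: R ^+ 2 = N%:R ^+ 2 by move/eqP; rewrite eqrXn2 ?ler0n // => /eqP.
have -> : R ^+ 2 = \prod_(a <- eigs) (2 + a ^+ 2).
  rewrite [RHS](bigID (fun a => 0 < a)) /= expr2; congr (_ * _).
  rewrite /R (perm_big _ eigenvalues_sym) big_map /=.
  rewrite big_seq_cond [RHS]big_seq_cond; apply: eq_big => [a|a _]; last by rewrite sqrrN.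
  case: (boolP (a \in eigs)) => //= a_eig; rewrite oppr_gt0.
  have a_neq0 : a != 0 by apply: contraNneq eigenvalues_neq0 => <-.
  by rewrite (real_ltNge (eigenvalues_real a_eig)) ?real0 // le0r (negPf a_neq0).
have qN : q.[-2] = (-1) ^+ m * N%:R.
  rewrite horner_sum natr_sum mulr_sumr; apply: eq_bigr => s _.
  have k_le : (k s <= m)%N by rewrite half_leq // max_card.
  rewrite hornerZ hornerXn natrX -[in RHS](subnKC k_le) exprD.
  by rewrite (subnKC k_le) -mulrA -exprMn mulN1r.
(* Evaluating at [z] and at [-z] gives [q.[-2]] twice, and (z - a)(-z - a) = a^2 - z^2 = 2 + a^2. *)
pose z := sqrtC (-2 : C).
have q_z : q.[z ^+ 2] ^+ 2 = \prod_(a <- eigs) (2 + a ^+ 2).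
  rewrite expr2 {1}hornerE_eigs -sqrrN hornerE_eigs -big_split /=.
  apply: eq_bigr => a _.
  by rewrite -opprD mulrN -subr_sqr opprB sqrtCK opprK addrC.
by rewrite -q_z sqrtCK qN exprMn sqrr_sign mul1r.
Qed.

End TreeSpectrum.

Theorem theorem14 (C : numClosedFieldType) (T : sgraph) (treeT : tree T)
    (pmT : exists M : {set {set T}}, perfect_matching M) :
  (Pm (cart_prod (path_graph 3) T))%:R =
    \prod_(a <- graph_eigenvalues C T | 0 < a) (2 + a ^+ 2) :> C.
Proof.
have [_ acycT] := treeT; have [M /mate_of_mates/matesP[pi_adj piK]] := pmT.
(* Both sides become sums over the matchings of [T], compared term by term. *)
rewrite (prod_eigenvalues C acycT piK pi_adj) (Pm_path3 acycT piK pi_adj).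
congr (_%:R); apply: eq_bigr => s s_match.
have /matchingsP[s_loc sK] := s_match.
have k_le : (#|moved s|./2 <= #|T|./2)%N by rewrite half_leq // max_card.
apply/eqP; rewrite -(eqn_pmul2r (_ : 0 < 2 ^ #|moved s|./2)%N) ?expn_gt0 //.
by rewrite (card_colorings acycT piK sK pi_adj s_loc) -expnD subnK.
Qed.
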